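(* For any positive integer $n$ and any integer $k\ge 10$, $$\tilde{r}(P_k,P_n) \geq \frac{5}{3} n + \frac{k}{9} - 4.$$
   Context: $P_\ell$ denotes the path on $\ell$ vertices ($\ell-1$ edges). For finite graphs $G,H$, the online Ramsey number $\tilde{r}(G,H)$ is defined via the following game $\tilde{R}(G,H)$ between two players, Builder and Painter, played on the infinite vertex set $\mathbb{N}$. In each round, Builder selects an edge between two vertices that has not been selected before, and Painter colours it red or blue. The game ends as soon as there is a red copy of $G$ or a blue copy of $H$. Builder aims to minimise the number of rounds, Painter to maximise it; $\tilde{r}(G,H)$ is the number of rounds the game lasts when both players play optimally.
   Formalization: For n=1 a blue copy of P_1 is required to be an endpoint of a blue edge; with the usual meaning a single vertex is already a copy, the game lasts 0 rounds, and the bound fails for n=1, k≥22. For n≥2 the notion of copy is the usual one. *)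

(* Defs.v *)
From mathcomp Require Import all_boot all_order all_algebra.
From mathcomp Require Import boolp classical_sets reals ereal.

Set Implicit Arguments.
Unset Strict Implicit.
Unset Printing Implicit Defensive.

Import Order.TTheory GRing.Theory Num.Theory.
Local Open Scope classical_set_scope.
Local Open Scope ring_scope.

Record sgraph := SGraph {
  vertex :> finType;
  adj : rel vertex;
  adj_sym : symmetric adj;
  adj_irr : irreflexive adj }.

Definition path_rel (l : nat) : rel 'I_l :=
  fun i j => (i.+1 == j :> nat) || (j.+1 == i :> nat).

Lemma path_rel_sym l : symmetric (@path_rel l).
Proof. by move=> i j; rewrite /path_rel orbC. Qed.

Lemma path_rel_irr l : irreflexive (@path_rel l).
Proof. by move=> i; rewrite /path_rel orbb gtn_eqF. Qed.

(* [l] is the number of vertices. *)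
Definition path_graph (l : nat) : sgraph :=
  SGraph (@path_rel_sym l) (@path_rel_irr l).

(* The edge {x, y} of the complete graph on nat is encoded by the pair (x, y)
   with x < y. *)
Definition edge : Type := nat * nat.

Definition is_edge (e : edge) : bool := (e.1 < e.2)%N.

Definition color : Type := bool.
Definition red : color := true.
Definition blue : color := false.

(* The most recent round is the head of the list. *)
Definition history : Type := seq (edge * color).

Definition colored_adj (h : history) (c : color) (x y : nat) : bool :=
  (((x, y), c) \in h) || (((y, x), c) \in h).

(* The graph of colour c consists of the edges of colour c and of their
   endpoints, hence the last clause: a vertex of a copy has to be a vertex of
   that graph.  For G without isolated vertices the clause is implied by the
   previous one; it only matters for graphs such as [path_graph 1], a copy of
   which appears with the first edge of colour c (the bare vertices of the
   board do not count as being coloured). *)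
Definition has_copy (G : sgraph) (c : color) (h : history) : Prop :=
  exists f : G -> nat,
    [/\ injective f,
        forall u v : G, adj u v -> colored_adj h c (f u) (f v) &
        forall u : G, exists y : nat, colored_adj h c (f u) y].

Definition game_over (G H : sgraph) (h : history) : Prop :=
  has_copy G red h \/ has_copy H blue h.

Definition builder_strategy : Type := history -> edge.
Definition painter_strategy : Type := history -> edge -> color.

(* Since the board is infinite, a fresh edge exists after every history, so
   asking for a legal move at all histories (including those that cannot
   arise) does not restrict Builder. *)
Definition legal_builder (sB : builder_strategy) : Prop :=
  forall h : history, is_edge (sB h) /\ sB h \notin unzip1 h.

Definition play_round (sB : builder_strategy) (sP : painter_strategy)
    (h : history) : history :=
  (sB h, sP h (sB h)) :: h.

Definition play (sB : builder_strategy) (sP : painter_strategy) (t : nat) :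
    history :=
  iter t (play_round sB sP) [::].

(* First round after which the game is over; +oo if there is none.  The moves
   that [play] still makes after that round are irrelevant. *)
Definition duration (R : realType) (G H : sgraph)
    (sB : builder_strategy) (sP : painter_strategy) : \bar R :=
  ereal_inf [set (t%:R)%:E | t in [set t : nat | game_over G H (play sB sP t)]].

Definition online_ramsey (R : realType) (G H : sgraph) : \bar R :=
  ereal_inf [set ereal_sup [set duration R G H sB sP | sP in setT]
            | sB in [set sB | legal_builder sB]].

(* Main.v *)
(** Painter first follows a base strategy whose red components are trees of
depth at most 4, hence contain no red path on 10 vertices.  Once following it
would have completed a blue P_n, Painter colours everything red unless this
closes a red P_k; since a red P_k contains an edge of this second phase among
any 9 consecutive edges, Builder then needs at least k/9 - 1 rounds, and it
remains to see that the first phase lasts 5n/3 - 3 rounds.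

In the base strategy a component on three vertices becomes a core.  An isolated
vertex, or either end of a red K_2, joined to a core vertex is attached in red
as a branch.  The first edge from an isolated vertex to a branch is blue;
a later one is red and turns the vertex into a tip.  Edges from isolated
vertices to tips, and all remaining edges, are blue.  Thus a vertex of the blue
P_n without red edges has at most one branch neighbour, the other one being
a tip, and a tip has a blue edge, dating from before it had red ones, to a
branch or to a tip.  If the path does not use that edge, the edge is wasted;
if it does, the path is forced to pay elsewhere.  Sharing the red edges among
the vertices and scanning the path from one end, a potential argument yields
2n/3 - 1 red or wasted edges. *)

Require Import Defs.
From mathcomp Require Import all_boot all_order all_algebra.
From mathcomp Require Import boolp classical_sets reals ereal.
From mathcomp Require Import zify lra.
Import Order.TTheory GRing.Theory Num.Theory.

(** * The base strategy *)

Inductive label := Isolated | Paired | Core | Branch | Tip.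

(* The parent of a [Paired] vertex is the other end of its red edge, whichever
   of the two is the root. *)
Record info := Info { lab : label; dep : nat; par : nat }.

Definition label_code (l : label) : nat :=
  match l with
  | Isolated => 0 | Paired => 1 | Core => 2 | Branch => 3 | Tip => 4
  end.

Definition upd (s : nat -> info) (x : nat) (a : info) : nat -> info :=
  fun z => if z == x then a else s z.

Definition incident_blue (h : history) (x : nat) : bool :=
  has (fun ec => (ec.2 == blue) && ((ec.1.1 == x) || (ec.1.2 == x))) h.

(** Only pairs ordered by [label_code] are submitted to it. An edge between two red pairs creates a
    red path on four vertices: its inner vertex [x] becomes the root of the core, and the mate of
    [y] a branch. *)
Definition respond (h : history) (s : nat -> info) (x y : nat) :
    color * (nat -> info) :=
  match lab (s x), lab (s y) with
  | Isolated, Isolated =>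
      (red, upd (upd s x (Info Paired 0 y)) y (Info Paired 1 x))
  | Isolated, Paired =>
      (red, upd (upd (upd s y (Info Core 0 y)) (par (s y)) (Info Core 1 y))
                x (Info Core 1 y))
  | Isolated, Core => (red, upd s x (Info Branch (dep (s y)).+1 y))
  | Isolated, Branch =>
      if incident_blue h x then (red, upd s x (Info Tip (dep (s y)).+1 y))
      else (blue, s)
  | Paired, Paired =>
      (red, upd (upd (upd (upd s x (Info Core 0 x)) (par (s x)) (Info Core 1 x))
                     y (Info Core 1 x)) (par (s y)) (Info Branch 2 y))
  | Paired, Core =>
      (red, upd (upd s x (Info Branch (dep (s y)).+1 y))
                (par (s x)) (Info Branch (dep (s y)).+2 x))
  | _, _ => (blue, s)
  end.

Definition base_move (h : history) (s : nat -> info) (e : edge) :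
    color * (nat -> info) :=
  if label_code (lab (s e.1)) <= label_code (lab (s e.2))
  then respond h s e.1 e.2 else respond h s e.2 e.1.

(** The state depends on the edges alone, latest first, so Painter can recompute it even after
    deviating from the base strategy. *)
Fixpoint base_run (es : seq edge) : history * (nat -> info) :=
  if es is e :: es' then
    let hs := base_run es' in
    let m := base_move hs.1 hs.2 e in ((e, m.1) :: hs.1, m.2)
  else ([::], fun=> Info Isolated 0 0).

(* Six times the share of the red edges given to a vertex: each core has three
   core vertices and two edges, and every other non-isolated vertex of its
   component brings one edge. *)
Definition weight (l : label) : nat :=
  match l with
  | Isolated => 0 | Paired => 3 | Core => 4 | Branch => 6 | Tip => 6
  end.

Definition outer (l : label) : Prop := l = Branch \/ l = Tip.
Definition small (l : label) : Prop := l = Isolated \/ l = Paired.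

(** A core has depth 1, a pair attached to it reaches depth 3, and a tip hangs from a branch. *)
Definition max_depth (l : label) : nat :=
  match l with
  | Isolated => 4 | Paired => 1 | Core => 1 | Branch => 3 | Tip => 4
  end.

(** The depth condition discards the self-parent at the root of a core and orients the mutual
    parents of a red pair. *)
Definition child (s : nat -> info) (x y : nat) : Prop :=
  par (s x) = y /\ dep (s x) = (dep (s y)).+1.

Definition red_size (h : history) : nat := count (fun ec => ec.2 == red) h.

(** [inv_small] holds since edges from small vertices to small or core vertices are always red, and
    outer labels are final. [inv_weight] ranges over finite lists because the board is infinite. *)
Record labelling (h : history) (s : nat -> info) : Prop := Labelling {
  inv_isolated : forall x y, lab (s x) = Isolated -> ~ colored_adj h red x y;
  inv_mate : forall x, lab (s x) = Paired ->
    [/\ lab (s (par (s x))) = Paired, par (s (par (s x))) = x &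
        colored_adj h red x (par (s x))];
  inv_paired : forall x y, lab (s x) = Paired -> colored_adj h red x y ->
    y = par (s x);
  inv_tree : forall x y, colored_adj h red x y -> child s x y \/ child s y x;
  inv_depth : forall x, dep (s x) <= max_depth (lab (s x));
  inv_weight : forall v, uniq v ->
    \sum_(z <- v) weight (lab (s z)) <= 6 * red_size h;
  inv_small : forall x y, colored_adj h blue x y -> small (lab (s x)) ->
    outer (lab (s y));
  inv_branch : forall x y z, lab (s x) = Isolated ->
    colored_adj h blue x y -> colored_adj h blue x z ->
    lab (s y) = Branch -> lab (s z) = Branch -> y = z;
  (* [x F(x)] is a blue edge drawn while [x] was isolated; the last clause keeps
     an edge from playing this role for both of its ends. *)
  inv_tip : exists F : nat -> nat, forall x, lab (s x) = Tip ->
    [/\ colored_adj h blue x (F x), outer (lab (s (F x))) &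
        lab (s (F x)) = Tip -> F (F x) <> x] }.

(** * Preservation of the invariant in one round *)

Lemma colored_adj_sym h c x y : colored_adj h c x y = colored_adj h c y x.
Proof. by rewrite /colored_adj orbC. Qed.

Lemma incident_blueP h x :
  reflect (exists y, colored_adj h blue x y) (incident_blue h x).
Proof.
apply: (iffP hasP) => [[[[a b] c] hin /= /andP[/eqP cb /orP[]/eqP E]] | [y]].
- by exists b; rewrite /colored_adj -E -cb hin.
- by exists a; rewrite /colored_adj -E -cb hin orbT.
case/orP=> hin.
- by exists ((x, y), blue) => //=; rewrite !eqxx.
- by exists ((y, x), blue) => //=; rewrite !eqxx orbT.
Qed.

(** Vertices outside [t] contribute no growth, and those of [t] missing from [v] only help; the sums
    are placed so as to avoid subtraction. *)
Lemma weight_relabel s s' (t v : seq nat) : uniq v -> uniq t ->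
  (forall z, z \notin t -> s' z = s z) ->
  (forall z, z \in t -> weight (lab (s z)) <= weight (lab (s' z))) ->
  \sum_(z <- v) weight (lab (s' z)) + \sum_(z <- t) weight (lab (s z))
    <= \sum_(z <- v) weight (lab (s z)) + \sum_(z <- t) weight (lab (s' z)).
Proof.
move=> uv ut Eo le; pose d z := weight (lab (s' z)) - weight (lab (s z)).
have E z : weight (lab (s' z)) = weight (lab (s z)) + d z.
  rewrite /d subnKC //; have [zt|zt] := boolP (z \in t); first exact: le.
  by rewrite Eo.
have D r : \sum_(z <- r) weight (lab (s' z))
         = \sum_(z <- r) weight (lab (s z)) + \sum_(z <- r) d z.
  by rewrite -big_split /=; apply: eq_bigr => z _; rewrite E.
rewrite !D -addnA leq_add2l addnC leq_add2l.
rewrite (bigID (mem t)) /= [X in _ + X]big1 ?addn0; last first.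
  by move=> z zt; rewrite /d Eo ?subnn.
rewrite -big_filter (perm_big [seq z <- t | z \in v]) /=; last first.
  by apply: uniq_perm; rewrite ?filter_uniq // => z; rewrite !mem_filter andbC.
by rewrite big_filter big_mkcond leq_sum //= => z _; case: ifP.
Qed.

(* The new edge [(x, y)] may be stored as [(y, x)]. *)
Definition extends (h h' : history) (c : color) (x y : nat) : Prop :=
  (forall c' a b, colored_adj h' c' a b =
     colored_adj h c' a b ||
     (c' == c) && ((a == x) && (b == y) || (a == y) && (b == x))) /\
  red_size h' = (c == red) + red_size h.

Lemma extends_cons h c x y : extends h (((x, y), c) :: h) c x y.
Proof.
split=> // c' a b; rewrite /colored_adj !inE !xpair_eqE.
by do 2!case: (_ \in h); rewrite ?orbT ?orbF //=;
  case: (c' == c); rewrite ?andbF ?andbT //= (andbC (b == x)).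
Qed.

Lemma extends_sym h h' c x y : extends h h' c x y -> extends h h' c y x.
Proof.
by case=> A B; split=> // c' a b; rewrite A [X in _ || _ && X]orbC.
Qed.

(** Labels and red edges stay, so the side conditions are just [inv_small] and [inv_branch] for the
    new edge, read from both ends. *)
Lemma labelling_blue h h' s x y :
  labelling h s -> extends h h' blue x y ->
  (small (lab (s x)) -> outer (lab (s y))) ->
  (small (lab (s y)) -> outer (lab (s x))) ->
  (lab (s x) = Isolated -> lab (s y) = Branch ->
     forall z, ~ colored_adj h blue x z) ->
  (lab (s y) = Isolated -> lab (s x) = Branch ->
     forall z, ~ colored_adj h blue y z) ->
  labelling h' s.
Proof.
move=> I [A B] sx sy fx fy.
have R a b : colored_adj h' red a b = colored_adj h red a b by rewrite A orbF.
have Bl a b : colored_adj h' blue a b ->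
    [\/ colored_adj h blue a b, a = x /\ b = y | a = y /\ b = x].
  rewrite A /= => /orP[|/orP[]/andP[/eqP-> /eqP->]]; first by constructor 1.
  - by constructor 2.
  - by constructor 3.
split.
- by move=> a b; rewrite R; apply: inv_isolated I _ _.
- by move=> a /(inv_mate _ _ I); rewrite R.
- by move=> a b; rewrite R; apply: inv_paired I _ _.
- by move=> a b; rewrite R; apply: inv_tree I _ _.
- exact: inv_depth I.
- by rewrite B; apply: inv_weight I.
- move=> a b /Bl[|[-> ->]|[-> ->]] //; exact: inv_small I _ _.
- move=> a b c la /Bl[ab|[ax bY]|[aY bx]] /Bl[ac|[ax' cY]|[aY' cx]] lb lc;
    subst; try by [].
  + exact: (inv_branch _ _ I a).
  + by case: (fx _ _ b).
  + by case: (fy _ _ b).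
  + by case: (fx _ _ c).
  + by case: (fy _ _ c).
- have [F HF] := inv_tip _ _ I; exists F => a la.
  by have [H1 H2 H3] := HF a la; split=> //; rewrite A H1.
Qed.

(* [t] lists the vertices which get a new label. *)
Lemma labelling_red h h' s s' x y (t : seq nat) :
  labelling h s -> extends h h' red x y -> uniq t ->
  (forall z, z \notin t -> s' z = s z) ->
  (x \notin t -> ~ small (lab (s x))) -> (y \notin t -> ~ small (lab (s y))) ->
  (child s' x y \/ child s' y x) ->
  (forall z, z \in t -> [/\ small (lab (s z)), lab (s' z) <> Isolated,
     dep (s' z) <= max_depth (lab (s' z)) &
     weight (lab (s z)) <= weight (lab (s' z))]) ->
  (forall z, z \in t -> lab (s' z) = Tip ->
     lab (s z) = Isolated /\ exists b, colored_adj h blue z b) ->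
  (forall z, z \in t -> lab (s z) = Paired ->
     par (s z) \in t /\ (child s' z (par (s z)) \/ child s' (par (s z)) z)) ->
  (forall z, z \in t -> lab (s' z) = Paired ->
     [/\ lab (s z) = Isolated, lab (s' (par (s' z))) = Paired,
         par (s' (par (s' z))) = z &
         (z = x /\ par (s' z) = y) \/ (z = y /\ par (s' z) = x)]) ->
  \sum_(z <- t) weight (lab (s' z)) = \sum_(z <- t) weight (lab (s z)) + 6 ->
  labelling h' s'.
Proof.
move=> I [A B] ut Eo Tx Ty Hxy T HT HP HP' W.
have Bl a b : colored_adj h' blue a b = colored_adj h blue a b.
  by rewrite A orbF.
have R a b : colored_adj h' red a b ->
    [\/ colored_adj h red a b, a = x /\ b = y | a = y /\ b = x].
  rewrite A /= => /orP[|/orP[]/andP[/eqP-> /eqP->]]; first by constructor 1.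
  - by constructor 2.
  - by constructor 3.
have out z : outer (lab (s z)) -> s' z = s z.
  move=> o; apply: Eo; apply/negP=> /T[+ _ _ _].
  by case: o => -> [].
have sm z : small (lab (s' z)) -> small (lab (s z)).
  by have [/T[]|/Eo->] := boolP (z \in t).
have HI z : lab (s' z) = Isolated -> lab (s z) = Isolated /\ z \notin t.
  by have [/T[]|/[dup] /Eo->] := boolP (z \in t).
have mate z : lab (s z) = Paired -> par (s z) \in t -> z \in t.
  move=> lz; have [m1 m2 m3] := inv_mate _ _ I z lz.
  by case/HP; rewrite ?m2.
split.
- move=> a b /[dup] la /HI[l nt] /R[|[ax _]|[ay _]].
  + exact: inv_isolated I _ _ l.
  + by subst a; case: (Tx nt); left.
  + by subst a; case: (Ty nt); left.
- move=> a; have [ta|/[dup] nta /Eo Ea] := boolP (a \in t).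
    move=> /HP'[] // l m1 m2 m3; split=> //; rewrite A /=.
    by case: m3 => -[-> ->]; rewrite !eqxx ?orbT.
  rewrite Ea => la; have [l1 l2 l3] := inv_mate _ _ I a la.
  by rewrite Eo ?A ?l3 //; apply/negP=> /(mate _ la); apply/negP.
- move=> a b; have [ta|/[dup] nta /Eo Ea] := boolP (a \in t).
    move=> /HP'[] // l m1 m2 m3 /R[ab|[ax bY]|[ay bx]].
    + by case: (inv_isolated _ _ I _ _ l ab).
    + by case: m3 => -[]; congruence.
    + by case: m3 => -[]; congruence.
  rewrite Ea => la /R[ab|[ax _]|[ay _]].
  + exact: inv_paired I _ _ la ab.
  + by subst a; case: (Tx nta); right.
  + by subst a; case: (Ty nta); right.
- move=> a b /R[ab|[-> ->]|[-> ->]] //; last by case: Hxy; [right|left].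
  have ba : colored_adj h red b a by rewrite colored_adj_sym.
  have P c d : colored_adj h red c d -> c \in t ->
      child s' c d \/ child s' d c.
    move=> cd ct; have [[lc|lc] _ _ _] := T c ct.
      by case: (inv_isolated _ _ I _ _ lc cd).
    by rewrite (inv_paired _ _ I _ _ lc cd); case: (HP c ct lc).
  have [/(P _ _ ab)//|/Eo Ea] := boolP (a \in t).
  have [/(P _ _ ba)|/Eo Eb] := boolP (b \in t); first by case; [right|left].
  by rewrite /child Ea Eb; apply: inv_tree I _ _ ab.
- move=> z; have [/T[]//|/Eo->] := boolP (z \in t); exact: inv_depth I z.
- move=> v uv; rewrite B /= mulnDr muln1 addnC.
  rewrite -(leq_add2r (\sum_(z <- t) weight (lab (s z)))).
  apply: leq_trans (weight_relabel s s' t v uv ut Eo _) _.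
    by move=> z /T[].
  by rewrite W addnA addnAC !leq_add2r; apply: inv_weight I _ uv.
- move=> a b; rewrite Bl => ab /sm la.
  by have o := inv_small _ _ I _ _ ab la; rewrite out.
- move=> a b c /HI[la _]; rewrite !Bl => ab ac.
  have sa : small (lab (s a)) by left.
  rewrite (out b) ?(out c); last 2 first.
  + exact: inv_small I _ _ ac sa.
  + exact: inv_small I _ _ ab sa.
  exact: inv_branch I _ _ _ la ab ac.
- have [F HF] := inv_tip _ _ I.
  (* A new tip was isolated with a blue edge, and any such edge can serve as its early one; old tips
     keep theirs. *)
  pose G z := if lab (s z) is Isolated then
    xget 0 [set b | colored_adj h blue z b]%classic else F z.
  exists G => z lz.
  have GF w : lab (s w) = Tip -> G w = F w by rewrite /G => ->.
  have : lab (s z) = Tip \/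
         lab (s z) = Isolated /\ exists b, colored_adj h blue z b.
    have [zt|/Eo E] := boolP (z \in t); first by right; apply: HT.
    by left; rewrite -E.
  case=> [l|[l [b zb]]].
    have [H1 H2 H3] := HF z l.
    rewrite Bl GF // out //; split=> // l'; rewrite GF //; exact: H3.
  have zG : colored_adj h blue z (G z).
    by rewrite /G l; case: xgetP => [w _ //|/(_ b)]; rewrite /= zb.
  have o : outer (lab (s (G z))) by apply: inv_small I _ _ zG _; left.
  (* If the early edge of the old tip [G z] led to [z], then [z] would have been outer, but it was
     isolated. *)
  rewrite Bl out //; split=> // l'; rewrite GF // => E.
  by have [_] := HF _ l'; rewrite E l => -[].
Qed.

Lemma respond_labelling h h' s x y :
  labelling h s -> x <> y -> (forall c, ~ colored_adj h c x y) ->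
  label_code (lab (s x)) <= label_code (lab (s y)) ->
  extends h h' (respond h s x y).1 x y -> labelling h' (respond h s x y).2.
Proof.
move=> I /eqP xy new; rewrite /respond.
have Dx := inv_depth _ _ I x; have Dy := inv_depth _ _ I y.
have M z : lab (s z) = Paired ->
    [/\ lab (s (par (s z))) = Paired, par (s (par (s z))) = z & z != par (s z)].
  move=> lz; have [m1 m2 m3] := inv_mate _ _ I z lz; split=> //.
  by apply/eqP=> E; case: (inv_tree _ _ I _ _ m3) => -[]; rewrite -E; lia.
(* This settles every case with a fixed blue answer. The bullets treat isolated-isolated,
   isolated-paired, isolated-core, isolated-branch, paired-paired and paired-core. *)
case lx: (lab (s x)); case ly: (lab (s y)) => //= _; rewrite ?lx ?ly in Dx Dy;
  try (move=> E; solve [apply: labelling_blue I E _ _ _ _;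
                        rewrite /outer /small lx ly; intuition congruence]).
- move=> E; set s' := upd _ _ _.
  have Ex : s' x = Info Paired 0 y by rewrite /s' /upd (negbTE xy) eqxx.
  have Ey : s' y = Info Paired 1 x by rewrite /s' /upd eqxx.
  have ab z : z \in [:: x; y] -> z = x \/ z = y.
    by rewrite !inE => /orP[]/eqP; auto.
  apply: (labelling_red _ _ _ _ _ _ [:: x; y] I E).
  + by rewrite /= inE xy.
  + by move=> z; rewrite !inE /s' /upd; case: eqP; case: eqP.
  + by rewrite !inE eqxx.
  + by rewrite !inE eqxx orbT.
  + by right; rewrite /child Ex Ey.
  + by move=> z /ab[]->; rewrite ?Ex ?Ey ?lx ?ly; split=> //; left.
  + by move=> z /ab[]->; rewrite ?Ex ?Ey.
  + by move=> z /ab[]->; rewrite ?lx ?ly.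
  + by move=> z /ab[]->; rewrite ?Ex ?Ey /= ?Ex ?Ey; split; auto.
  + by rewrite !big_cons !big_nil Ex Ey lx ly.
- move=> E; have [mp1 mp2 mp3] := M y ly; set p := par (s y) in mp1 mp2 mp3 *.
  have xp : x != p by apply/eqP=> E1; rewrite -E1 lx in mp1.
  set s' := upd _ _ _.
  have Ex : s' x = Info Core 1 y by rewrite /s' /upd eqxx.
  have Ey : s' y = Info Core 0 y.
    by rewrite /s' /upd eq_sym (negbTE xy) (negbTE mp3) eqxx.
  have Ep : s' p = Info Core 1 y.
    by rewrite /s' /upd eq_sym (negbTE xp) eqxx.
  have ab z : z \in [:: x; y; p] -> [\/ z = x, z = y | z = p].
    by rewrite !inE => /or3P[]/eqP; [constructor 1|constructor 2|constructor 3].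
  apply: (labelling_red _ _ _ _ _ _ [:: x; y; p] I E).
  + by rewrite /= !inE negb_or xy xp mp3.
  + by move=> z; rewrite !inE /s' /upd; case: eqP; case: eqP; case: eqP.
  + by rewrite !inE eqxx.
  + by rewrite !inE eqxx orbT.
  + by left; rewrite /child Ex Ey.
  + by move=> z /ab[]->; rewrite ?Ex ?Ey ?Ep ?lx ?ly ?mp1;
      split=> //; rewrite /small; auto.
  + by move=> z /ab[]->; rewrite ?Ex ?Ey ?Ep.
  + move=> z /ab[]->; rewrite ?lx // => _.
      by rewrite -/p !inE eqxx !orbT; split=> //; right; rewrite /child Ep Ey.
    by rewrite mp2 !inE eqxx orbT; split=> //; left; rewrite /child Ep Ey.
  + by move=> z /ab[]->; rewrite ?Ex ?Ey ?Ep.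
  + by rewrite !big_cons !big_nil Ex Ey Ep lx ly mp1.
- move=> E; set s' := upd _ _ _.
  have Ex : s' x = Info Branch (dep (s y)).+1 y by rewrite /s' /upd eqxx.
  have Ey : s' y = s y by rewrite /s' /upd eq_sym (negbTE xy).
  apply: (labelling_red _ _ _ _ _ _ [:: x] I E) => //.
  + by move=> z; rewrite !inE /s' /upd; case: eqP.
  + by rewrite !inE eqxx.
  + by rewrite /small ly => _ [].
  + by left; rewrite /child Ex Ey.
  + move=> z /[!inE] /eqP ->; rewrite Ex lx; split=> //; first by left.
    by move: Dy => /=; lia.
  + by move=> z /[!inE] /eqP ->; rewrite Ex.
  + by move=> z /[!inE] /eqP ->; rewrite lx.
  + by move=> z /[!inE] /eqP ->; rewrite Ex.
  + by rewrite !big_cons !big_nil Ex lx.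
- case inc: (incident_blue h x) => /= E; last first.
    apply: labelling_blue I E _ _ _ _; rewrite /outer /small ?lx ?ly; auto.
    + by case.
    + by move=> _ _ z xz; move/incident_blueP: inc; apply; exists z.
    + by [].
  set s' := upd _ _ _.
  have Ex : s' x = Info Tip (dep (s y)).+1 y by rewrite /s' /upd eqxx.
  have Ey : s' y = s y by rewrite /s' /upd eq_sym (negbTE xy).
  apply: (labelling_red _ _ _ _ _ _ [:: x] I E) => //.
  + by move=> z; rewrite !inE /s' /upd; case: eqP.
  + by rewrite !inE eqxx.
  + by rewrite /small ly => _ [].
  + by left; rewrite /child Ex Ey.
  + by move=> z /[!inE] /eqP ->; rewrite Ex lx; split=> //; left.
  + by move=> z /[!inE] /eqP -> _; split=> //; apply/incident_blueP.
  + by move=> z /[!inE] /eqP ->; rewrite lx.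
  + by move=> z /[!inE] /eqP ->; rewrite Ex.
  + by rewrite !big_cons !big_nil Ex lx.
- move=> E; have [mp1 mp2 mp3] := M x lx; have [mq1 mq2 mq3] := M y ly.
  have py : par (s x) != y.
    apply/eqP=> E1; have [_ _] := inv_mate _ _ I x lx.
    by rewrite E1; apply: new.
  set p := par (s x) in mp1 mp2 mp3 py *; set q := par (s y) in mq1 mq2 mq3 *.
  have xq : x != q by apply: contraNneq py => E1; rewrite /p E1 mq2.
  have pq : p != q by apply: contraNneq xy => E1; rewrite -mp2 E1 mq2.
  set s' := upd _ _ _.
  have Ex : s' x = Info Core 0 x.
    by rewrite /s' /upd (negbTE xq) (negbTE xy) (negbTE mp3) eqxx.
  have Ep : s' p = Info Core 1 x.
    by rewrite /s' /upd (negbTE pq) (negbTE py) eqxx.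
  have Ey : s' y = Info Core 1 x by rewrite /s' /upd (negbTE mq3) eqxx.
  have Eq : s' q = Info Branch 2 y by rewrite /s' /upd eqxx.
  have ab z : z \in [:: x; y; p; q] -> [\/ z = x, z = y, z = p | z = q].
    by rewrite !inE => /or4P[]/eqP;
      [constructor 1|constructor 2|constructor 3|constructor 4].
  apply: (labelling_red _ _ _ _ _ _ [:: x; y; p; q] I E).
  + by rewrite /= !inE !negb_or xy xq mp3 (eq_sym y) py mq3 pq.
  + by move=> z; rewrite !inE /s' /upd; do 4!case: eqP => //=.
  + by rewrite !inE eqxx.
  + by rewrite !inE eqxx orbT.
  + by right; rewrite /child Ex Ey.
  + by move=> z /ab[]->; rewrite ?Ex ?Ey ?Ep ?Eq ?lx ?ly ?mp1 ?mq1;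
      split=> //; right.
  + by move=> z /ab[]->; rewrite ?Ex ?Ey ?Ep ?Eq.
  + move=> z /ab[]-> _; rewrite -?/p -?/q ?mp2 ?mq2 !inE eqxx ?orbT;
      by split=> //; rewrite /child ?Ex ?Ey ?Ep ?Eq; auto.
  + by move=> z /ab[]->; rewrite ?Ex ?Ey ?Ep ?Eq.
  + by rewrite !big_cons !big_nil Ex Ey Ep Eq lx ly mp1 mq1.
- move=> E; have [mp1 mp2 mp3] := M x lx; set p := par (s x) in mp1 mp2 mp3 *.
  have py : p != y by apply/eqP=> E1; rewrite E1 ly in mp1.
  set s' := upd _ _ _.
  have Ex : s' x = Info Branch (dep (s y)).+1 y.
    by rewrite /s' /upd (negbTE mp3) eqxx.
  have Ep : s' p = Info Branch (dep (s y)).+2 x by rewrite /s' /upd eqxx.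
  have Ey : s' y = s y.
    by rewrite /s' /upd !(eq_sym y) (negbTE xy) (negbTE py).
  have ab z : z \in [:: x; p] -> z = x \/ z = p.
    by rewrite !inE => /orP[]/eqP; auto.
  apply: (labelling_red _ _ _ _ _ _ [:: x; p] I E).
  + by rewrite /= inE mp3.
  + by move=> z; rewrite !inE /s' /upd; case: eqP; case: eqP.
  + by rewrite !inE eqxx.
  + by rewrite /small ly => _ [].
  + by left; rewrite /child Ex Ey.
  + move: Dy => /= Dy z /ab[]->; rewrite ?Ex ?Ep ?lx ?mp1 /=.
      by split=> //; [right|lia].
    by split=> //; right.
  + by move=> z /ab[]->; rewrite ?Ex ?Ep.
  + move=> z /ab[]-> _; rewrite -?/p ?mp2 !inE eqxx ?orbT;
      by split=> //; rewrite /child ?Ex ?Ep; auto.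
  + by move=> z /ab[]->; rewrite ?Ex ?Ep.
  + by rewrite !big_cons !big_nil Ex Ep lx mp1.
Qed.

Lemma base_run_labelling es :
  uniq es -> all is_edge es ->
  unzip1 (base_run es).1 = es /\ labelling (base_run es).1 (base_run es).2.
Proof.
elim: es => [|[a b] es IH] /=.
  move=> _ _; split=> //; split=> //=.
  - by move=> v _; rewrite big1.
  - by exists id.
case/andP=> nes ues /andP[ab aes]; have [E I] := IH ues aes.
split; first by rewrite E.
rewrite /base_move /=; set h := (base_run es).1 in E I *.
set s := (base_run es).2 in I *.
have new c : ~ colored_adj h c a b.
  case/orP=> /(map_f fst) /=; rewrite -/(unzip1 _) E => hin.
    by rewrite hin in nes.
  by have := allP aes _ hin; rewrite /is_edge /= ltnNge (ltnW ab).
have nab : a <> b by move=> eab; move: ab; rewrite /is_edge /= eab ltnn.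
case: leqP => le.
- by apply: (respond_labelling _ _ _ _ _ I nab new le); apply: extends_cons.
- apply: (respond_labelling _ _ _ _ _ I _ _ (ltnW le)).
  + by move=> /esym.
  + by move=> c; rewrite colored_adj_sym.
  + by apply: extends_sym; apply: extends_cons.
Qed.

(** * Red and blue paths in the base strategy *)

(** After a step down the path cannot turn back: the only way up leads to the parent, which it has
    just left. *)
Lemma red_path_down h s z x p : labelling h s -> child s x z ->
  path (colored_adj h red) x p -> uniq (z :: x :: p) ->
  dep (s (last x p)) = dep (s x) + size p.
Proof.
move=> I; elim: p z x => [|y p IH] z x xz /=; first by rewrite addn0.
case/andP=> xy yp; rewrite !inE !negb_or.
move=> /andP[/and3P[zx zy zp] /andP[/andP[xy' xp] uyp]].
have [[E _]|yx] := inv_tree _ _ I _ _ xy.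
  by case: xz => E' _; rewrite -E -E' eqxx in zy.
have [_ Dy] := yx.
rewrite (IH x y yx yp) ?Dy ?addSnnS //=.
by rewrite inE negb_or xy' xp.
Qed.

(** The path climbs at most [dep (s x)] times; once it descends, it goes on descending and ends at
    depth at most 4. *)
Lemma red_path_dep h s x p : labelling h s ->
  path (colored_adj h red) x p -> uniq (x :: p) -> size p <= dep (s x) + 4.
Proof.
move=> I; elim: p x => [|y p IH] x //= /andP[xy yp] /[dup] /andP[_ uyp] u.
have [[_ Dx]|yx] := inv_tree _ _ I _ _ xy.
  by rewrite Dx addSn ltnS IH.
have [_ Dy] := yx.
have := red_path_down _ _ _ _ _ I yx yp u.
have := inv_depth _ _ I (last y p).
by case: (lab _) => /=; lia.
Qed.

Lemma no_long_red_path h s v : labelling h s -> uniq v ->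
  sorted (colored_adj h red) v -> size v <= 9.
Proof.
move=> I; case: v => [|x p] //= u xp.
have := red_path_dep _ _ _ _ I xp u; have := inv_depth _ _ I x.
by case: (lab _) => /=; lia.
Qed.

(* Types of the vertices along a blue path: a red-isolated vertex is a gap, and
   a tip is classified by whether its early blue edge leads to its predecessor,
   to its successor, or is not on the path. *)
Inductive spot :=
  | GapAfterBranch | Gap | PairedSpot | CoreSpot | BranchSpot
  | TipLeft | TipRight | TipWaste.

(** Small vertices have only outer blue neighbours, [inv_branch] bars a gap between two branches,
    early edges end at outer vertices, and no edge is the early edge of both its ends, which bars
    [TipLeft] after [TipRight]. *)
Definition follows (a b : spot) : bool :=
  match a, b with
  | GapAfterBranch, (TipRight | TipWaste)
  | (Gap | PairedSpot), (BranchSpot | TipRight | TipWaste)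
  | CoreSpot, (CoreSpot | BranchSpot | TipRight | TipWaste)
  | BranchSpot, (GapAfterBranch | PairedSpot | CoreSpot | BranchSpot
                | TipLeft | TipRight | TipWaste)
  | (TipLeft | TipWaste), (Gap | PairedSpot | CoreSpot | BranchSpot
                          | TipLeft | TipRight | TipWaste)
  | TipRight, (BranchSpot | TipRight | TipWaste) => true
  | _, _ => false
  end.

(** Six times the red share, plus 6 for the edge wasted at [TipWaste]; the target of 2/3 per vertex
    becomes 4 per spot. *)
Definition spot_value (a : spot) : nat :=
  match a with
  | GapAfterBranch | Gap => 0 | PairedSpot => 3 | CoreSpot => 4
  | BranchSpot | TipLeft | TipRight => 6 | TipWaste => 12
  end.

(* The largest deficit, relative to 4 per spot, that the spots after [a] can
   accumulate. *)
Definition potential (a : spot) : nat :=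
  match a with
  | GapAfterBranch => 0 | Gap | PairedSpot | CoreSpot | TipRight => 2
  | BranchSpot => 4 | TipLeft | TipWaste => 6
  end.

(** On every allowed pair the value of the second spot covers 4 plus the change of potential, so the
    inequality telescopes. *)
Lemma follows_value a l : path follows a l ->
  4 * size l <= \sum_(b <- l) spot_value b + potential a.
Proof.
elim: l a => [|b l IH] a //= /andP[ab /IH]; rewrite big_cons.
have : 4 + potential b <= spot_value b + potential a.
  by move: ab; case: a; case: b.
set S := \sum_(_ <- _) _; lia.
Qed.

Section BluePath.
Variables (h : history) (s : nat -> info) (F : nat -> nat).
Hypothesis lhs : labelling h s.
Hypothesis tipF : forall x, lab (s x) = Tip ->
  [/\ colored_adj h blue x (F x), outer (lab (s (F x))) &
      lab (s (F x)) = Tip -> F (F x) <> x].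

(* [p] and [r] are the neighbours of [x] on the path, if they exist. *)
Definition spot_at (p : option nat) (x : nat) (r : option nat) : spot :=
  match lab (s x) with
  | Isolated => if p is Some y then
                  if lab (s y) is Branch then GapAfterBranch else Gap
                else Gap
  | Paired => PairedSpot
  | Core => CoreSpot
  | Branch => BranchSpot
  | Tip => if p == Some (F x) then TipLeft
           else if r == Some (F x) then TipRight else TipWaste
  end.

Fixpoint spots (p : option nat) (v : seq nat) : seq spot :=
  if v is x :: v' then spot_at p x (ohead v') :: spots (Some x) v' else [::].

Fixpoint wasted (p : option nat) (v : seq nat) : seq nat :=
  if v is x :: v' then
    if spot_at p x (ohead v') is TipWaste then x :: wasted (Some x) v'
    else wasted (Some x) v'
  else [::].

Lemma spot_at_follows p x y r : colored_adj h blue x y ->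
  (if p is Some z then colored_adj h blue z x && (z != y) else true) ->
  follows (spot_at p x (Some y)) (spot_at (Some x) y r).
Proof.
move=> xy px.
have yx : colored_adj h blue y x by rewrite colored_adj_sym.
have Sx := inv_small _ _ lhs _ _ xy; have Sy := inv_small _ _ lhs _ _ yx.
have tip_left z w : colored_adj h blue z w -> lab (s w) = Tip ->
    ~ outer (lab (s z)) -> (Some z == Some (F w)) = false.
  move=> zw lw nz; apply/eqP=> -[E]; apply: nz; rewrite E.
  by have [] := tipF _ lw.
rewrite /spot_at; case lx: (lab (s x)) Sx Sy => Sx Sy.
- have [ly|ly] := Sx (or_introl erefl); rewrite ly.
  + case: p px => [z /andP[zx zy]|//]; case lz: (lab (s z)) => //.
    rewrite colored_adj_sym in zx.
    by rewrite (inv_branch _ _ lhs _ _ _ lx xy zx ly lz) eqxx in zy.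
  + rewrite tip_left // ?lx; last by case.
    by case: p {px} => [z|]; [case: (lab (s z))|]; case: ifP.
- have [ly|ly] := Sx (or_intror erefl); rewrite ly //.
  by rewrite tip_left // ?lx; [case: ifP|case].
- case ly: (lab (s y)) Sy => Sy //.
  + by case: (Sy (or_introl erefl)).
  + by case: (Sy (or_intror erefl)).
  + by rewrite tip_left // ?lx; [case: ifP|case].
- by case ly: (lab (s y)) => //; do 2!case: ifP => //.
- case ly: (lab (s y)) => //; rewrite ?lx; do 2?case: ifP => //.
  all: try by do 2?case: ifP.
  all: try by move=> /eqP[E]; have [_] := tipF _ lx; rewrite -E ly => -[].
  move=> /eqP[Ey] _; have [_ _ ny] := tipF _ lx.
  case: eqP => [[Ex]|_]; last by case: ifP.
  by case: ny; rewrite -?Ey.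
Qed.

Lemma path_spots p x v : path (colored_adj h blue) x v -> uniq (x :: v) ->
  (if p is Some z then colored_adj h blue z x && (z \notin x :: v) else true) ->
  path follows (spot_at p x (ohead v)) (spots (Some x) v).
Proof.
elim: v p x => [|y v IH] p x //= /andP[xy yv] /andP[xNyv uyv] px.
apply/andP; split; last by apply: IH; rewrite ?xy.
apply: spot_at_follows => //; case: p px => // z /andP[-> /=].
by rewrite !inE !negb_or => /and3P[].
Qed.

Lemma size_spots p v : size (spots p v) = size v.
Proof. by elim: v p => //= x v IH p; rewrite IH. Qed.

Lemma sum_spots p v : \sum_(b <- spots p v) spot_value b =
  \sum_(z <- v) weight (lab (s z)) + 6 * size (wasted p v).
Proof.
elim: v p => [|x v IH] p /=; first by rewrite !big_nil.
rewrite !big_cons IH.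
have -> : spot_value (spot_at p x (ohead v)) = weight (lab (s x)) +
    (if spot_at p x (ohead v) is TipWaste then 6 else 0).
  rewrite /spot_at; case: (lab (s x)) => //; last by do 2?case: ifP.
  by case: p => // z; case: (lab (s z)).
by case: spot_at => /=; lia.
Qed.

Lemma subseq_wasted p v : subseq (wasted p v) v.
Proof.
elim: v p => //= x v IH p.
by case: spot_at; rewrite ?eqxx //; apply: subseq_trans (IH _) (subseq_cons _ _).
Qed.

Definition norm_edge (x y : nat) : edge := (minn x y, maxn x y).

Lemma norm_edge_inj a b c d : norm_edge a b = norm_edge c d ->
  a = c /\ b = d \/ a = d /\ b = c.
Proof. by case; lia. Qed.

Lemma norm_edgeC a b : norm_edge a b = norm_edge b a.
Proof. by rewrite /norm_edge minnC maxnC. Qed.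

Lemma pairmap_norm_edge x v e : e \in pairmap norm_edge x v ->
  exists a b, [/\ a \in x :: v, b \in v & e = norm_edge a b].
Proof.
elim: v x => //= y v IH x; rewrite inE => /orP[/eqP->|/IH[a [b [av bv ->]]]].
  by exists x, y; rewrite !inE !eqxx.
by exists a, b; rewrite in_cons av orbT inE bv orbT.
Qed.

Lemma uniq_pairmap_norm_edge x v : uniq (x :: v) -> uniq (pairmap norm_edge x v).
Proof.
elim: v x => //= y v IH x /andP[xNyv uyv]; rewrite IH // andbT.
apply/negP=> /pairmap_norm_edge[a [b [av bv /norm_edge_inj[]]]] [Ex Ey].
  by rewrite Ex av in xNyv.
by rewrite Ex in_cons bv orbT in xNyv.
Qed.

(** A path edge at [z] leads to a neighbour of [z] on the path, and [TipWaste] means that [F z] is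
    none. The edge from the predecessor [p] is carried along for the induction. *)
Lemma wasted_spec p x v z : uniq (x :: v) ->
  (if p is Some y then y \notin x :: v else true) -> z \in wasted p (x :: v) ->
  [/\ lab (s z) = Tip, norm_edge z (F z) \notin pairmap norm_edge x v &
      if p is Some y then norm_edge z (F z) <> norm_edge y x else True].
Proof.
elim: v p x z => [|y v IH] p x z.
  move=> _ px /=; rewrite /spot_at; case lx: (lab (s x)) => //=.
  - by case: p {px} => // w; case: (lab (s w)).
  - case: eqP => // px'; rewrite inE => /eqP->; split=> //.
    by case: p px px' => // w; rewrite inE => wx nw /norm_edge_inj[[]|[_ E]];
      [move=> E; rewrite E eqxx in wx|case: nw; rewrite E].
move=> u px zw.
have [E|zv] : z = x /\ spot_at p x (Some y) = TipWaste \/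
    z \in wasted (Some x) (y :: v).
- move: zw; rewrite [wasted p _]/=; case E: spot_at; try by right.
  by rewrite inE => /orP[/eqP->|]; [left|right].
- case: E => -> {z zw}; rewrite /spot_at; case lx: (lab (s x)) => //.
    by case: p {px} => // w; case: (lab (s w)).
  case: eqP => // px'; case: eqP => // yF _; split=> //.
    rewrite /= inE negb_or; apply/andP; split.
      by apply/eqP=> /norm_edge_inj[[_ E]|[E E']]; apply: yF; rewrite ?E' E.
    apply/negP=> /pairmap_norm_edge[a [b [av bv /norm_edge_inj[]]]] [Ex _].
      by rewrite /= Ex av in u.
    by rewrite /= Ex in_cons bv orbT in u.
  case: p px px' => // w; rewrite inE negb_or => /andP[wx _] nw.
  move=> /norm_edge_inj[[E _]|[_ E]]; first by rewrite E eqxx in wx.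
  by case: nw; rewrite E.
have /andP[xNyv uyv] := u.
have [lz nz nx] := IH (Some x) y z uyv xNyv zv.
have zyv := mem_subseq (subseq_wasted (Some x) (y :: v)) zv.
split=> //.
  by rewrite /= inE negb_or nz andbT; apply/eqP.
case: p px {zw} => // w; rewrite inE negb_or => /andP[_ wNyv].
move=> /norm_edge_inj[[E _]|[E _]]; first by rewrite -E zyv in wNyv.
by rewrite -E zyv in xNyv.
Qed.

Lemma blue_norm_edge a b : all is_edge (unzip1 h) -> colored_adj h blue a b ->
  norm_edge a b \in [seq ec.1 | ec <- h & ec.2 == blue].
Proof.
move=> ae ab; apply/mapP; case/orP: ab => hin;
  have := allP ae _ (map_f fst hin); rewrite /is_edge /= => lt.
- exists ((a, b), blue); rewrite ?mem_filter ?hin //= /norm_edge.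
  by congr pair; lia.
- exists ((b, a), blue); rewrite ?mem_filter ?hin //= /norm_edge.
  by congr pair; lia.
Qed.

End BluePath.

Lemma red_blue_size (h : history) :
  size h = red_size h + size [seq ec.1 | ec <- h & ec.2 == blue].
Proof.
rewrite size_map size_filter -(count_predC (fun ec => ec.2 == red)).
by congr addn; apply: eq_count => -[e []].
Qed.

(** For m path vertices, r red, b blue and w wasted edges, the scan gives 4m <= 6r + 6w + 6, and
    counting blue edges gives m - 1 + w <= b. Adding six times the second to the first eliminates
    w. *)
Lemma blue_path_cost h s v : labelling h s -> all is_edge (unzip1 h) ->
  uniq v -> sorted (colored_adj h blue) v -> 5 * size v <= 3 * size h + 6.
Proof.
move=> I ae; case: v => [|x v] // u; rewrite [sorted _ _]/= => xv.
have [F tipF] := inv_tip _ _ I.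
have := follows_value _ _ (path_spots _ _ _ I tipF None x v xv u isT).
have init : 4 + potential (spot_at s F None x (ohead v)) <=
    spot_value (spot_at s F None x (ohead v)) + 6 by case: spot_at.
have := sum_spots s F None (x :: v).
set W := wasted s F None (x :: v); rewrite [spots _ _ _ _]/= big_cons size_spots.
have wt := inv_weight _ _ I _ u.
have B : size v + size W <= size [seq ec.1 | ec <- h & ec.2 == blue].
  have -> : size v + size W = size (pairmap norm_edge x v ++
      [seq norm_edge z (F z) | z <- W]).
    by rewrite size_cat size_map size_pairmap.
  have WP := wasted_spec s F None x v.
  apply: uniq_leq_size.
    rewrite cat_uniq uniq_pairmap_norm_edge //=; apply/andP; split.
      apply/hasPn=> e /mapP[z zW ->].
      by have [_] := WP z u isT zW.
    (* Two tips wasting the same edge would be each other's image under [F], against [tipF]. *)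
    rewrite map_inj_in_uniq ?(subseq_uniq (subseq_wasted s F None _)) //.
    move=> z w zW wW /norm_edge_inj[[]//|[Ez Ew]].
    have [lz _ _] := WP z u isT zW; have [lw _ _] := WP w u isT wW.
    by have [_ _] := tipF z lz; rewrite Ew => /(_ lw) []; rewrite -Ez.
  move=> e; rewrite mem_cat => /orP[|/mapP[z zW ->]]; last first.
    apply: blue_norm_edge => //.
    by have [lz _ _] := WP z u isT zW; have [] := tipF z lz.
  elim: v x xv {u W WP wt init} => //= y v IH x /andP[xy yv].
  rewrite inE => /orP[/eqP->|]; last exact: IH.
  exact: blue_norm_edge.
have := red_blue_size h; move: wt B init; rewrite big_cons [size (x :: v)]/=.
move: (size W) (size [seq _ | _ <- _ & _]) (red_size h) (size h) (size v).
move: (\sum_(j <- v) _) (\sum_(j <- spots _ _ _ _) _).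
move: (weight _) (spot_value _) (potential _).
lia.
Qed.

(** * The second phase *)

Lemma count_windows (p : pred nat) q :
  (forall j, j < q -> has p (iota (9 * j) 9)) -> q <= count p (iota 0 (9 * q)).
Proof.
elim: q => // q IH H; rewrite mulnS addnC iotaD count_cat add0n -addn1.
by rewrite leq_add -?has_count ?H // IH // => j jq; apply: H; rewrite ltnS ltnW.
Qed.

(** Nine consecutive old edges would form an old red path on 10 vertices, so each full window of
    nine edges contains a new one, and these are distinct entries of [l]. The incomplete last window
    accounts for the successor in the bound. *)
Lemma red_path_new_edges (l h : history) v :
  (forall w, uniq w -> sorted (colored_adj h red) w -> size w <= 9) ->
  uniq v -> sorted (colored_adj (l ++ h) red) v -> size v <= 9 * (size l).+1.
Proof.
move=> short uv /(sortedP 0) sv.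
pose new i := ~~ colored_adj h red (nth 0 v i) (nth 0 v i.+1).
pose g i := norm_edge (nth 0 v i) (nth 0 v i.+1).
set m := (size v).-1; set q := m %/ 9.
have le_new : count new (iota 0 m) <= size l.
  rewrite -size_filter -(size_map g).
  rewrite -(size_map (fun ec => norm_edge ec.1.1 ec.1.2) l).
  have small i : i \in [seq j <- iota 0 m | new j] -> i.+1 < size v.
    by rewrite mem_filter mem_iota => /andP[_]; rewrite /m; lia.
  apply: uniq_leq_size.
    rewrite map_inj_in_uniq ?filter_uniq ?iota_uniq // => i j /small im /small jm.
    move=> /norm_edge_inj[] [/eqP E /eqP E']; move: E E';
      rewrite !nth_uniq //; lia.
  move=> e /mapP[i im ->]; have := sv i (small i im).
  move: im; rewrite mem_filter => /andP[+ _]; rewrite /new /colored_adj !mem_cat.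
  rewrite negb_or => /andP[/negbTE-> /negbTE->]; rewrite !orbF.
  case/orP=> hin; apply/mapP.
    by exists ((nth 0 v i, nth 0 v i.+1), red).
  by exists ((nth 0 v i.+1, nth 0 v i), red) => //=; rewrite /g norm_edgeC.
have le_q : q <= count new (iota 0 (9 * q)).
  apply: count_windows => j jq; apply: contraT => /hasPn nn.
  have jm : 9 * j + 9 < size v.
    by have := leq_trunc_div m 9; move: jq; rewrite /q /m; lia.
  have sz : size (take 10 (drop (9 * j) v)) = 10.
    by rewrite size_takel // size_drop; lia.
  have : size (take 10 (drop (9 * j) v)) <= 9.
    apply: short; first by rewrite take_uniq ?drop_uniq.
    apply/(sortedP 0) => i; rewrite sz => i10.
    rewrite (nth_take _ i10) (nth_take _ (ltnW i10)) !nth_drop.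
    rewrite addnS; apply: contraT => hn.
    have := nn (9 * j + i); rewrite mem_iota /new hn => /(_ _)/negP; case=> //.
    lia.
  by rewrite sz.
have : count new (iota 0 (9 * q)) <= count new (iota 0 m).
  have -> : m = 9 * q + (m - 9 * q).
    by have := leq_trunc_div m 9; rewrite -/q; lia.
  by rewrite iotaD count_cat leq_addr.
have mq : m < q.+1 * 9 by apply: ltn_ceil.
have : size v <= m.+1 by rewrite /m leqSpred.
move: mq le_q le_new; clearbody q m.
move: (count _ _) (count _ _) (size l) (size v).
lia.
Qed.

Lemma path_copy_seq l c h : has_copy (path_graph l) c h ->
  exists v, [/\ size v = l, uniq v & sorted (colored_adj h c) v].
Proof.
case=> f [fi fa _]; exists [seq f i | i <- enum 'I_l]; split.
- by rewrite size_map size_enum_ord.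
- by rewrite map_inj_uniq ?enum_uniq.
- apply/(sortedP 0) => i; rewrite size_map size_enum_ord => il.
  have il' : i < l by apply: ltnW.
  have nE j (jl : j < l) : nth 0 [seq f i | i <- enum 'I_l] j = f (Ordinal jl).
    rewrite (nth_map (Ordinal jl)) ?size_enum_ord //.
    by congr f; apply: val_inj; rewrite /= nth_enum_ord.
  rewrite !nE; apply: fa.
  by rewrite /= /path_rel /= eqxx.
Qed.

Lemma has_copy_sub G c h h' :
  (forall x y, colored_adj h c x y -> colored_adj h' c x y) ->
  has_copy G c h -> has_copy G c h'.
Proof.
move=> sub [f [fi fa fe]]; exists f; split=> //.
  by move=> u v /fa /sub.
by move=> u; have [y /sub hy] := fe u; exists y.
Qed.

Lemma has_copy_cons G c h a : has_copy G c h -> has_copy G c (a :: h).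
Proof.
apply: has_copy_sub => x y; rewrite /colored_adj !inE.
by case/orP=> ->; rewrite !orbT.
Qed.

(** * Painter's strategy and the length of the game *)

Section Game.
Variables (n k : nat).
Hypotheses (hn : 1 <= n) (hk : 10 <= k).

(** This concerns the colours that the base strategy would have given, not those on the board, and
    so remains true once true. *)
Definition base_blue (es : seq edge) : Prop :=
  has_copy (path_graph n) blue (base_run es).1.

Definition painter : painter_strategy := fun h e =>
  if `[< base_blue (e :: unzip1 h) >]
  then ~~ `[< has_copy (path_graph k) red ((e, red) :: h) >]
  else (base_move (base_run (unzip1 h)).1 (base_run (unzip1 h)).2 e).1.

Variable sB : builder_strategy.
Hypothesis legal : legal_builder sB.

Let board t := play sB painter t.

Lemma board_legal t : uniq (unzip1 (board t)) /\ all is_edge (unzip1 (board t)).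
Proof.
elim: t => //= t [IHu IHe]; have [e ne] := legal (board t).
by rewrite /= -/(board t) ne e IHu IHe.
Qed.

Lemma board_cat t t' : t <= t' -> exists l, size l = t' - t /\
  board t' = l ++ board t.
Proof.
elim: t' => [|t' IH].
  by rewrite leqn0 => /eqP->; exists [::].
rewrite leq_eqVlt => /orP[/eqP->|]; first by exists [::]; rewrite subnn.
rewrite ltnS => /[dup] le /IH[l [sl E]].
exists ((sB (board t'), painter (board t') (sB (board t'))) :: l).
by rewrite /= sl subSn //= -E.
Qed.

Lemma board_base t : ~ base_blue (unzip1 (board t)) ->
  board t = (base_run (unzip1 (board t))).1.
Proof.
elim: t => //= t IH nb.
have nb' : ~ base_blue (unzip1 (board t)).
  by move=> b; apply: nb; apply: has_copy_cons.
rewrite /= -/(board t) -IH //; congr cons; congr pair.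
by rewrite /painter; case: asboolP => [/nb|_] //; rewrite -IH.
Qed.

Lemma board_no_long_red t w : ~ base_blue (unzip1 (board t)) -> uniq w ->
  sorted (colored_adj (board t) red) w -> size w <= 9.
Proof.
move=> nb; have [u e] := board_legal t; have [_ I] := base_run_labelling _ u e.
by move: I; rewrite -board_base // => I; apply: no_long_red_path I.
Qed.

(** The cost of a blue path is applied to the base run on the same edges, even where Painter has
    deviated from it. *)
Lemma base_blue_size t : base_blue (unzip1 (board t)) -> 5 * n <= 3 * t + 6.
Proof.
have [u e] := board_legal t; have [E I] := base_run_labelling _ u e.
move=> /path_copy_seq[v [<- uv sv]].
have := blue_path_cost _ _ _ I _ uv sv; rewrite E => /(_ e).
have sz : size (base_run (unzip1 (board t))).1 = t.
  rewrite -(size_map fst) -/(unzip1 _) E size_map.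
  by elim: t {u e E I v uv sv} => //= t ->.
by rewrite sz.
Qed.

Lemma first_base_blue t : base_blue (unzip1 (board t)) ->
  exists t1, [/\ t1 < t, ~ base_blue (unzip1 (board t1)) &
                 base_blue (unzip1 (board t1.+1))].
Proof.
(* On the empty board no copy exists: by [hn] it would have a vertex, which must lie on a coloured
   edge. *)
elim: t => [[f [_ _ /(_ (Ordinal hn))[y]]]//|t IH b].
have [bt|nb] := pselect (base_blue (unzip1 (board t))); last by exists t.
by have [t1 [lt1 h1 h2]] := IH bt; exists t1; split=> //; apply: ltnW.
Qed.

Lemma base_blue_later t t' : t <= t' -> base_blue (unzip1 (board t)) ->
  base_blue (unzip1 (board t')).
Proof.
elim: t' => [|t' IH]; first by rewrite leqn0 => /eqP->.
rewrite leq_eqVlt => /orP[/eqP->//|]; rewrite ltnS => le /(IH le) b.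
exact: has_copy_cons.
Qed.

(** After round [t1] Painter answers red unless this closes a red path on [k] vertices; before the
    first such occasion no blue edge is added. *)
Lemma red_until_threat t1 t : t1 <= t -> ~ base_blue (unzip1 (board t1)) ->
  base_blue (unzip1 (board t1.+1)) ->
  (exists t2, [/\ t1 <= t2, t2 < t &
    has_copy (path_graph k) red ((sB (board t2), red) :: board t2)]) \/
  ~ has_copy (path_graph k) red (board t) /\
  (forall x y, colored_adj (board t) blue x y ->
     colored_adj (board t1) blue x y).
Proof.
move=> le nb b; elim: t le => [|t IH].
  rewrite leqn0 => /eqP E; right; split; last by rewrite E.
  rewrite /board /= => /path_copy_seq[v [sv _]].
  by move: hk; rewrite -sv; case: v {sv} => [|x [|y v]].
rewrite leq_eqVlt => /orP[/eqP<-|].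
  right; split=> // /path_copy_seq[v [sv uv]] /(board_no_long_red _ _ nb uv).
  by rewrite sv leqNgt hk.
rewrite ltnS => le; have [[t2 [h1 h2 h3]]|[nk sub]] := IH le.
  by left; exists t2; split=> //; apply: ltnW.
have [c|nc] := pselect
  (has_copy (path_graph k) red ((sB (board t), red) :: board t)).
  by left; exists t.
have E : board t.+1 = (sB (board t), red) :: board t.
  rewrite /board /= /play_round -/(board t); congr cons; congr pair.
  rewrite /painter; case: asboolP => [_|nb']; first by case: asboolP.
  by case: nb'; apply: base_blue_later _ _ (le : t1.+1 <= t.+1) b.
right; rewrite E; split=> // x y; rewrite /colored_adj !inE !xpair_eqE !andbF /=.
exact: sub.
Qed.

(** The game cannot end before Painter first avoids a red path on [k] vertices, at [t2]. The avoided
    edge counts as new, so k <= 9(t2 - t1 + 2); adding three times 5n <= 3(t1 + 1) + 6 and using t2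
    < t gives the claim. *)
Lemma game_over_late t : game_over (path_graph k) (path_graph n) (board t) ->
  15 * n + k <= 9 * t + 36.
Proof.
move=> over.
have bt : base_blue (unzip1 (board t)).
  apply: contrapT => nb; case: over.
    move=> /path_copy_seq[v [sv uv]] /(board_no_long_red _ _ nb uv).
    by rewrite sv leqNgt hk.
  by rewrite board_base.
have [t1 [lt1 nb1 b1]] := first_base_blue _ bt.
have [[t2 [h1 h2]]|[nk sub]] := red_until_threat _ _ (ltnW lt1) nb1 b1;
  last first.
  case: over => // /(has_copy_sub _ _ _ _ sub).
  by rewrite board_base.
have [l [sl ->]] := board_cat _ _ h1.
rewrite -cat_cons => /path_copy_seq[v [sv uv]].
move=> /(red_path_new_edges _ _ _ (fun w => board_no_long_red _ w nb1) uv).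
have := base_blue_size _ b1; rewrite sv /= sl; lia.
Qed.

End Game.

Local Open Scope ring_scope.

Theorem theorem1p2 (R : realType) (n k : nat) (hn : (1 <= n)%N)
    (hk : (10 <= k)%N) :
  ((5 / 3 * n%:R + k%:R / 9 - 4 : R)%:E
     <= online_ramsey R (path_graph k) (path_graph n))%E.
Proof.
apply: le_ereal_inf_tmp => _ [sB legal <-].
pose d := duration R (path_graph k) (path_graph n) sB (painter n k).
apply: (@le_trans _ _ d); last first.
  by apply: ereal_sup_ubound; exists (painter n k).
apply: le_ereal_inf_tmp => _ [t over <-]; rewrite lee_fin.
have := game_over_late n k hn hk sB legal t over.
rewrite -(ler_nat R) (natrD _ (15 * n)) (natrD _ (9 * t)) !natrM; lra.
Qed.
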